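(* For every integer $n\ge 3$ there exist integers $j$ with $2\le j\le\lceil n/2\rceil$ and $k$ with $0\le k<\lceil\frac{n-2}{3}\rceil$ such that every doubling minimizer $\mu$ on $L_n$ satisfies $$\frac{\mu(B(j,1))}{\mu(B(j,0))}=\frac{\mu(B(1,2k+1))}{\mu(B(1,k))}=C_\mu.$$
   Context: $L_n$ is the path graph with vertices $\{1,\dots,n\}$ and edges $\{j,j+1\}$, with distance $|i-j|$. A measure $\mu$ on $L_n$ is a weight function $\mu:\{1,\dots,n\}\to(0,\infty)$, $\mu(A)=\sum_{v\in A}\mu(v)$. Closed balls: $B(x,r)=\{y:|x-y|\le r\}$. $C_\mu=\sup\{\mu(B(x,2k+1))/\mu(B(x,k)):1\le x\le n,\ k\ge 0\}$, $C_{L_n}=\inf_\mu C_\mu$. A doubling minimizer on $L_n$ is a measure $\mu$ with $C_\mu=C_{L_n}$. *)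

(* Defs.v *)
From HB Require Import structures.
From mathcomp Require Import all_boot all_order all_algebra.
From mathcomp Require Import boolp classical_sets reals.
From mathcomp Require Import Rstruct.
From Stdlib Require Rdefinitions.
Notation R := Rdefinitions.R.
Set Implicit Arguments. Unset Strict Implicit. Unset Printing Implicit Defensive.
Import Order.TTheory GRing.Theory Num.Theory.
Local Open Scope ring_scope.
Local Open Scope classical_set_scope.

(* Path graph L_n: vertices 1..n, distance |i - j|. *)
Definition ldist (i j : nat) : nat := (addn (subn i j) (subn j i)).

Definition ceil_div (a b : nat) : nat := divn (subn (addn a b) 1) b.

(* A measure on L_n: weight function positive on the vertices 1..n
   (values outside {1..n} are irrelevant). *)
Definition is_measure (n : nat) (mu : nat -> R) : Prop :=
  forall v : nat, (1 <= v <= n)%N -> 0 < mu v.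

Definition ball_mass (n : nat) (mu : nat -> R) (x r : nat) : R :=
  \sum_(1 <= y < n.+1 | (ldist x y <= r)%N) mu y.

Definition C_mu (n : nat) (mu : nat -> R) : R :=
  sup [set c | exists x k : nat, (1 <= x <= n)%N /\
         c = ball_mass n mu x (2 * k).+1 / ball_mass n mu x k].

Definition C_L (n : nat) : R :=
  inf [set c | exists mu : nat -> R, is_measure n mu /\ c = C_mu n mu].

Definition doubling_minimizer (n : nat) (mu : nat -> R) : Prop :=
  is_measure n mu /\ C_mu n mu = C_L n.

(* Main.v *)
(* For a fixed constant C the conditions mu(B(x,2k+1)) <= C mu(B(x,k)) are linear
   in mu.  Hence a sum of minimizers is a minimizer, whose tight constraints are
   tight for every summand; so there is a minimizer, symmetric under reflection,
   whose tight constraints are tight for all minimizers, and it suffices to find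
   one tight (j,0) with 1 < j < n and one tight (1,k) with 3(k+1) <= n for it.
   If such a tight constraint were missing, adding a small multiple of a suitable
   nu would make all constraints strict, lowering C.  For the first kind nu is the
   counting measure, as C > 7/3.  For the second kind nu(j) = sin(j pi/(n+1)), the
   eigenvector of nu |-> nu(B(.,1)) for 1 + 2cos(pi/(n+1)); pairing it with mu
   shows C > 1 + 2cos(pi/(n+1)) if (1,0) is not tight.  At the ends,
   sum_(i <= 2m) nu(i) <= (1 + 2cos(pi/(n+1))) sum_(i <= m) nu(i) once 3m > n, and
   on balls in the interior it is enough that nu is concave. *)
Require Import Defs.
From HB Require Import structures.
From mathcomp Require Import all_boot all_order all_algebra.
From mathcomp Require Import boolp classical_sets reals.
From mathcomp Require Import Rstruct.
From mathcomp Require Import trigo.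
From mathcomp Require Import zify ring lra.
From Stdlib Require Rdefinitions.
Import Order.TTheory GRing.Theory Num.Theory.
Set Implicit Arguments. Unset Strict Implicit. Unset Printing Implicit Defensive.
Local Open Scope ring_scope.
Local Notation R := Rdefinitions.R.

(** * Small perturbations of finitely many inequalities *)

Lemma exists_small_perturbation (F : realFieldType) (T : eqType) (s : seq T)
    (a b : T -> F) :
  (forall i, i \in s -> 0 <= a i) ->
  (forall i, i \in s -> 0 < a i \/ 0 < b i) ->
  exists2 e, 0 < e &
    forall e', 0 < e' <= e -> forall i, i \in s -> 0 < a i + e' * b i.
Proof.
elim: s => [|i s IHs] a0 ab0; first by exists 1.
have [||e e0 He] := IHs.
- by move=> j js; apply: a0; rewrite inE js orbT.
- by move=> j js; apply: ab0; rewrite inE js orbT.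
have a0i : 0 <= a i by apply: a0; rewrite mem_head.
have [d d0 Hd] : exists2 d, 0 < d &
    forall e', 0 < e' <= d -> 0 < a i + e' * b i.
  have [b0|bN] := ltP 0 (b i).
    by exists 1 => // e' /andP[e'0 _]; apply: ltr_wpDl => //; exact: mulr_gt0.
  have ai : 0 < a i by case: (ab0 i (mem_head _ _)) => //; rewrite ltNge bN.
  (* For [e'] up to this bound, [a i + e' * b i >= e']. *)
  exists (a i / (1 - b i)); first by apply: divr_gt0 => //; lra.
  move=> e' /andP[e'0]; rewrite ler_pdivlMr; last lra.
  nra.
exists (Num.min d e); first by rewrite lt_min d0 e0.
move=> e' /andP[e'0]; rewrite le_min => /andP[e'd e'e] j; rewrite inE.
by case/orP => [/eqP ->|js]; [apply: Hd | apply: He => //]; rewrite e'0.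
Qed.

(** * Ball masses as differences of prefix masses *)

Definition prefix_mass (mu : nat -> R) (i : nat) : R := \sum_(1 <= y < i.+1) mu y.

Lemma prefix_mass0 mu : prefix_mass mu 0 = 0.
Proof. by rewrite /prefix_mass big_geq. Qed.

Lemma prefix_massS mu i : prefix_mass mu i.+1 = prefix_mass mu i + mu i.+1.
Proof. by rewrite /prefix_mass big_nat_recr. Qed.

(** A ball is an interval: [minn] cuts it off at [n], and truncated subtraction makes the lower
    index 0 once the ball reaches vertex 1. *)
Lemma ball_mass_prefix n mu x r : (x <= n)%N ->
  ball_mass n mu x r =
    prefix_mass mu (minn n (x + r)) - prefix_mass mu (x - r).-1.
Proof.
move=> xn.
have pre b : \sum_(1 <= y < n.+1 | (y <= b)%N) mu y = prefix_mass mu (minn n b).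
  rewrite /prefix_mass [RHS](@big_nat_widen _ _ _ _ _ n.+1);
    last by rewrite ltnS geq_minl.
  by apply: congr_big_nat => // y yn; lia.
rewrite -pre (bigID (fun y => y <= (x - r).-1)%N) /=.
rewrite -[in X in _ - X](minn_idPr _ : minn n (x - r).-1 = _); last lia.
rewrite -pre addrC; apply/eqP; rewrite eq_sym subr_eq; apply/eqP; congr (_ + _).
  by apply: congr_big_nat => // y yn; rewrite /ldist; lia.
by apply: congr_big_nat => // y yn; lia.
Qed.

Lemma prefix_mass_lt n mu i j : is_measure n mu -> (i < j <= n)%N ->
  prefix_mass mu i < prefix_mass mu j.
Proof.
move=> mu0; elim: j => // j IHj; rewrite ltnS => /andP[ij jn].
have mj : 0 < mu j.+1 by apply: mu0; rewrite jn.
rewrite prefix_massS; move: ij; rewrite leq_eqVlt => /orP[/eqP ->|ij]; first lra.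
by have := IHj; rewrite ij ltnW // => /(_ isT); lra.
Qed.

Lemma prefix_mass_le n mu i j : is_measure n mu -> (i <= j <= n)%N ->
  prefix_mass mu i <= prefix_mass mu j.
Proof.
move=> mu0 /andP[]; rewrite leq_eqVlt => /orP[/eqP -> //|ij jn].
by apply/ltW/(@prefix_mass_lt n) => //; rewrite ij.
Qed.

Lemma ball_mass_gt0 n mu x r : is_measure n mu -> (1 <= x <= n)%N ->
  0 < ball_mass n mu x r.
Proof.
move=> mu0 xn; rewrite ball_mass_prefix; last by case/andP: xn.
by rewrite subr_gt0 (@prefix_mass_lt n) //; lia.
Qed.

Lemma ball_mass_large n mu x r : (x <= n <= r)%N ->
  ball_mass n mu x r = prefix_mass mu n.
Proof.
move=> xr; rewrite ball_mass_prefix; last lia.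
have -> : minn n (x + r) = n by lia.
have -> : (x - r).-1 = 0%N by lia.
by rewrite prefix_mass0 subr0.
Qed.

Lemma ball_massD n mu nu e x r :
  ball_mass n (fun y => mu y + e * nu y) x r
    = ball_mass n mu x r + e * ball_mass n nu x r.
Proof. by rewrite /ball_mass mulr_sumr -big_split. Qed.

Lemma ball_mass_reflect n mu x r : (1 <= x <= n)%N ->
  ball_mass n mu (n.+1 - x) r = ball_mass n (fun y => mu (n.+1 - y)%N) x r.
Proof.
move=> xn; rewrite /ball_mass big_nat_rev /=.
by apply: congr_big_nat => // y yn; rewrite /ldist; lia.
Qed.

(** * Doubling constants and their linear constraints *)

Lemma doubling_ratio_bounded n mu : is_measure n mu ->
  has_ubound [set c | exists x k : nat, (1 <= x <= n)%N /\
         c = ball_mass n mu x (2 * k).+1 / ball_mass n mu x k].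
Proof.
(* Every ball weighs at least as much as its centre, so this sum bounds the ratios for all of the
   infinitely many radii. *)
move=> mu0; exists (\sum_(1 <= y < n.+1) prefix_mass mu n / ball_mass n mu y 0).
have W0 : 0 <= prefix_mass mu n.
  by rewrite -(prefix_mass0 mu) (@prefix_mass_le n) //= leqnn.
have WB x r : (1 <= x <= n)%N -> prefix_mass mu n / ball_mass n mu x r <=
    \sum_(1 <= y < n.+1) prefix_mass mu n / ball_mass n mu y 0.
  move=> xn; rewrite (bigD1_seq x) ?iota_uniq ?mem_index_iota //=.
  apply: ler_wpDr.
    rewrite big_seq_cond; apply: sumr_ge0 => y /andP[].
    rewrite mem_index_iota => yn _.
    by rewrite divr_ge0 // ltW // ball_mass_gt0.
  rewrite ler_wpM2l // lef_pV2 ?posrE ?ball_mass_gt0 //.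
  rewrite !ball_mass_prefix; [|lia|lia].
  by apply: lerB; apply: (@prefix_mass_le n) => //; lia.
move=> c [x [k [xn ->]]]; apply: le_trans (WB x k xn).
rewrite ler_wpM2r ?invr_ge0 //; first exact/ltW/ball_mass_gt0.
rewrite ball_mass_prefix; last lia.
have := @prefix_mass_le n mu (minn n (x + (2 * k).+1)) n mu0.
have := @prefix_mass_le n mu 0 (x - (2 * k).+1).-1 mu0.
by rewrite prefix_mass0 geq_minl leqnn => /(_ ltac:(lia)) ? /(_ isT) ?; lra.
Qed.

Lemma C_mu_ub n mu x k : is_measure n mu -> (1 <= x <= n)%N ->
  ball_mass n mu x (2 * k).+1 <= C_mu n mu * ball_mass n mu x k.
Proof.
move=> mu0 xn; rewrite -ler_pdivrMr ?ball_mass_gt0 //.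
by apply: ub_le_sup; [exact: doubling_ratio_bounded | exists x, k].
Qed.

Lemma C_mu_le n mu c : (0 < n)%N -> is_measure n mu ->
  (forall x k, (1 <= x <= n)%N ->
     ball_mass n mu x (2 * k).+1 <= c * ball_mass n mu x k) ->
  C_mu n mu <= c.
Proof.
move=> n0 mu0 H; apply: ge_sup.
  by exists (ball_mass n mu 1 1 / ball_mass n mu 1 0), 1%N, 0%N; rewrite n0.
by move=> _ [x [k [xn ->]]]; rewrite ler_pdivrMr ?ball_mass_gt0 // H.
Qed.

Lemma C_mu_ge0 n mu : (0 < n)%N -> is_measure n mu -> 0 <= C_mu n mu.
Proof.
move=> n0 mu0; have n1 : (1 <= 1 <= n)%N by rewrite n0.
rewrite -(pmulr_lge0 _ (ball_mass_gt0 0 mu0 n1)).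
by apply: le_trans (C_mu_ub 0 mu0 n1); exact/ltW/ball_mass_gt0.
Qed.

Lemma C_L_le n mu : (0 < n)%N -> is_measure n mu -> C_L n <= C_mu n mu.
Proof.
move=> n0 mu0; apply: ge_inf; last by exists mu.
by exists 0 => _ [nu [nu0 ->]]; exact: C_mu_ge0.
Qed.

Lemma doubling_minimizerP n mu : (0 < n)%N -> is_measure n mu ->
  doubling_minimizer n mu <->
  forall x k, (1 <= x <= n)%N ->
    ball_mass n mu x (2 * k).+1 <= C_L n * ball_mass n mu x k.
Proof.
move=> n0 mu0; split=> [[_ <-] x k xn|H]; first exact: C_mu_ub.
by split=> //; apply/eqP; rewrite eq_le C_L_le // C_mu_le.
Qed.

(* Since [C_L n] does not depend on [mu], tightness is linear in [mu]. *)
Definition tight n mu x k :=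
  ball_mass n mu x (2 * k).+1 = C_L n * ball_mass n mu x k.

(** * Tight constraints under sums and reflection *)

Lemma not_tight_lt n mu x k : doubling_minimizer n mu -> (1 <= x <= n)%N ->
  ~ tight n mu x k ->
  ball_mass n mu x (2 * k).+1 < C_L n * ball_mass n mu x k.
Proof.
move=> [mu0 C] xn /eqP; rewrite lt_neqAle => -> /=.
by rewrite -C C_mu_ub.
Qed.

(** The factor [1] gives the sum the shape of [ball_massD]. *)
Lemma doubling_minimizerD n mu nu : (0 < n)%N ->
  doubling_minimizer n mu -> doubling_minimizer n nu ->
  doubling_minimizer n (fun y => mu y + 1 * nu y).
Proof.
move=> n0 Hmu Hnu; have [mu0 nu0] := (Hmu.1, Hnu.1).
have s0 : is_measure n (fun y => mu y + 1 * nu y).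
  by move=> v vn; have := mu0 v vn; have := nu0 v vn; lra.
apply/doubling_minimizerP => // x k xn; rewrite !ball_massD.
have /doubling_minimizerP -/(_ n0 mu0 x k xn) := Hmu.
have /doubling_minimizerP -/(_ n0 nu0 x k xn) := Hnu.
lra.
Qed.

Lemma tightD n mu nu x k : (1 <= x <= n)%N ->
  doubling_minimizer n mu -> doubling_minimizer n nu ->
  tight n (fun y => mu y + 1 * nu y) x k -> tight n mu x k /\ tight n nu x k.
Proof.
move=> xn Hmu Hnu; have n0 : (0 < n)%N by lia.
have /doubling_minimizerP -/(_ n0 Hmu.1 x k xn) := Hmu.
have /doubling_minimizerP -/(_ n0 Hnu.1 x k xn) := Hnu.
by rewrite /tight !ball_massD; split; lra.
Qed.

Lemma doubling_minimizer_reflect n mu : (0 < n)%N ->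
  doubling_minimizer n mu -> doubling_minimizer n (fun y => mu (n.+1 - y)%N).
Proof.
move=> n0 Hmu; have mu0 : is_measure n (fun y => mu (n.+1 - y)%N).
  by move=> v vn; apply: Hmu.1; lia.
apply/doubling_minimizerP => // x k xn; rewrite -!ball_mass_reflect //.
by have /doubling_minimizerP := Hmu; apply; [|exact: Hmu.1|lia].
Qed.

(** If a listed constraint is strict for some minimizer [nu], adding [nu] to the measure built so
    far makes it strict there; by [tightD] strictness survives further additions. *)
Lemma exists_common_tight n (s : seq (nat * nat)) mu : (0 < n)%N ->
  doubling_minimizer n mu ->
  exists2 mu0, doubling_minimizer n mu0 &
    forall x k, (x, k) \in s -> (1 <= x <= n)%N -> tight n mu0 x k ->
      forall nu, doubling_minimizer n nu -> tight n nu x k.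
Proof.
move=> n0 Hmu; elim: s => [|[x k] s [mu0 Hmu0 IH]]; first by exists mu.
have [Hx|/existsNP[nu /not_implyP[Hnu Nnu]]] :=
    pselect (forall nu, doubling_minimizer n nu -> tight n nu x k).
  exists mu0 => // y j; rewrite inE => /orP[/eqP[-> ->] //|]; exact: IH.
exists (fun y => mu0 y + 1 * nu y); first exact: doubling_minimizerD.
move=> y j; rewrite inE => yjs yn /tightD [] // tmu0 tnu.
case/orP: yjs => [/eqP[ey ej]|yjs]; last exact: IH.
by case: Nnu; rewrite -ey -ej.
Qed.

(* A direction [nu] that strictly relaxes every tight constraint would allow
   all ratios to drop below [C_L n] simultaneously. *)
Lemma no_improving_direction n mu nu : (0 < n)%N -> doubling_minimizer n mu ->
  ~ (forall x k, (1 <= x <= n)%N ->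
       ball_mass n mu x (2 * k).+1 < C_L n * ball_mass n mu x k \/
       ball_mass n nu x (2 * k).+1 < C_L n * ball_mass n nu x k).
Proof.
move=> n0 Hmu H; have mu0 := Hmu.1.
pose s := [seq (x, k) | x <- index_iota 1 n.+1, k <- index_iota 0 n.+1].
have sP p : p \in s -> (1 <= p.1 <= n)%N.
  by case/allpairsP => -[x k] /= []; rewrite !mem_index_iota => xn _ ->.
pose gap C m (p : nat * nat) :=
  C * ball_mass n m p.1 p.2 - ball_mass n m p.1 (2 * p.2).+1.
have [e1 e10 He1] : exists2 e, 0 < e & forall e', 0 < e' <= e ->
    forall p, p \in s -> 0 < gap (C_L n) mu p + e' * gap (C_L n) nu p.
  apply: exists_small_perturbation => p /sP xn; rewrite /gap.
    by rewrite subr_ge0; have /doubling_minimizerP := Hmu; apply.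
  by rewrite !subr_gt0; apply: H.
have [e2 e20 He2] : exists2 e, 0 < e & forall e', 0 < e' <= e ->
    forall v, v \in index_iota 1 n.+1 -> 0 < mu v + e' * nu v.
  apply: exists_small_perturbation => v; rewrite mem_index_iota => vn.
    by apply/ltW/mu0.
  by left; apply: mu0.
pose e := Num.min e1 e2; have e0 : 0 < e by rewrite lt_min e10.
pose m y := mu y + e * nu y.
have m0 : is_measure n m.
  by move=> v vn; apply: He2; rewrite ?mem_index_iota // e0 /= ge_min lexx orbT.
have gapm p : p \in s -> 0 < gap (C_L n) m p.
  move=> ps; have := He1 e _ p ps; rewrite e0 ge_min lexx => /(_ isT).
  by rewrite /gap !ball_massD; lra.
(* The slack gained is spent on lowering the constant to [C_L n - d]. *)
have [d d0 Hd] : exists2 d, 0 < d & forall d', 0 < d' <= d ->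
    forall p, p \in s -> 0 < gap (C_L n) m p + d' * - ball_mass n m p.1 p.2.
  by apply: exists_small_perturbation => p ps; [apply/ltW|left]; exact: gapm.
suff : C_mu n m <= C_L n - d by have := C_L_le n0 m0; lra.
apply: C_mu_le => // x k xn.
(* Balls of radius at least [n] are the whole path, so finitely many constraints suffice. *)
wlog kn : k / (k <= n)%N.
  move=> Hk; have [|/ltnW nk] := leqP k n; first exact: Hk.
  have := Hk n (leqnn n); rewrite !ball_mass_large //; lia.
have xks : (x, k) \in s.
  by apply/allpairsP; exists (x, k); rewrite !mem_index_iota xn ltnS kn.
by have := Hd d _ _ xks; rewrite d0 lexx /gap /= => /(_ isT); lra.
Qed.

(** * A tight constraint of radius 0 at an inner vertex *)

Lemma C_L_gt n mu : (3 <= n)%N -> doubling_minimizer n mu -> 7 / 3 < C_L n.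
Proof.
move=> n3 Hmu; have mu0 := Hmu.1; rewrite ltNge; apply/negP => C.
have n0 : (0 < n)%N by lia.
have [H1 H2 H3] : [/\ mu 1%N + mu 2%N <= C_L n * mu 1%N,
    mu 1%N + mu 2%N + mu 3%N <= C_L n * mu 2%N &
    mu 2%N + mu 3%N <= C_L n * mu 3%N].
  have H x : (1 <= x <= n)%N -> _ :=
    (doubling_minimizerP n0 mu0).1 Hmu x 0%N.
  have := H 1%N ltac:(lia); have := H 2%N ltac:(lia); have := H 3%N ltac:(lia).
  rewrite !ball_mass_prefix; [|lia..].
  have -> : minn n (1 + 0) = 1%N by lia.
  have -> : minn n (2 + 0) = 2%N by lia.
  have -> : minn n (3 + 0) = 3%N by lia.
  rewrite /= => h3 h2 h1.
  (* For [n > 3] the ball around 3 also contains 4, whose mass is dropped. *)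
  have := @prefix_mass_le n mu 3 (minn n (3 + (2 * 0).+1)) mu0 ltac:(lia).
  by move: h1 h2 h3; rewrite !prefix_massS prefix_mass0; split; lra.
(* With [C_L n <= 7 / 3], [mu 1] and [mu 3] are at least 3/4 of [mu 2], but their sum is at most 4/3
   of it. *)
have := mu0 1%N ltac:(lia); have := mu0 2%N ltac:(lia).
have := mu0 3%N ltac:(lia).
nra.
Qed.

Lemma prefix_mass1 i : prefix_mass (fun=> 1) i = i%:R.
Proof.
by elim: i => [|i IH]; rewrite ?prefix_mass0 // prefix_massS IH -natr1.
Qed.

Lemma exists_tight_center n mu : (3 <= n)%N -> doubling_minimizer n mu ->
  exists2 j, (2 <= j < n)%N & tight n mu j 0.
Proof.
move=> n3 Hmu; have C := C_L_gt n3 Hmu.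
have [//|Nj] := pselect (exists2 j, (2 <= j < n)%N & tight n mu j 0).
case: (@no_improving_direction n mu (fun=> 1)) => // [|x k xn]; first lia.
have [/andP[xi /eqP k0]|xk] := boolP ((2 <= x < n)%N && (k == 0)%N).
  left; rewrite k0; apply: not_tight_lt => // xt; apply: Nj.
  by exists x.
right; rewrite !ball_mass_prefix; [|lia..]; rewrite !prefix_mass1.
rewrite -!natrB; [|lia..].
set a := (_ - _)%N; set b := (minn n (x + k) - _)%N.
(* Untruncated balls have ratio (4k+3)/(2k+1), at most 7/3 for [k >= 1]; for [k = 0] only the end
   vertices are left, with ratio 2. *)
have [ab b0] : (3 * a <= 7 * b)%N /\ (0 < b)%N by rewrite /a /b; lia.
move: ab b0; rewrite -(ler_nat R) -(ltr_nat R) !natrM.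
nra.
Qed.

Lemma ball_mass_symmetric n mu x r :
  (forall v, (1 <= v <= n)%N -> mu (n.+1 - v)%N = mu v) ->
  (1 <= x <= n)%N -> ball_mass n mu (n.+1 - x) r = ball_mass n mu x r.
Proof.
move=> sym xn; rewrite ball_mass_reflect //.
rewrite /ball_mass [LHS]big_nat_cond [RHS]big_nat_cond.
by apply: eq_bigr => y /andP[yn _]; apply: sym.
Qed.

(** * Concave weights on inner balls *)

Definition concave_upto (N : nat) (f : nat -> R) :=
  forall i, (i.+2 <= N)%N -> f i + f i.+2 <= 2 * f i.+1.

(** Steps of [f] decrease, so the step following [i + p] bounds those on its left from below and
    those on its right from above. For [q = 0] that step may leave the range, hence the separate
    case. *)
Lemma concave_chord N f i p q : concave_upto N f -> (i + p + q <= N)%N ->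
  q%:R * f i + p%:R * f (i + p + q)%N <= (p + q)%:R * f (i + p)%N.
Proof.
move=> cf; case: q => [|q] N_; first by rewrite !addn0 mul0r add0r.
pose d j := f j.+1 - f j.
have dle j j' : (j <= j')%N -> (j' < N)%N -> d j' <= d j.
  move=> /subnK <-; elim: (j' - j)%N => // t IH tN.
  apply: le_trans (IH ltac:(lia)).
  by have := cf (t + j)%N tN; rewrite /d !addSn; lra.
have Hp t : (t <= p)%N -> t%:R * d (i + p)%N <= f (i + t)%N - f i.
  elim: t => [|t IH] tp; first by rewrite mul0r addn0 subrr.
  have := IH ltac:(lia); have := dle (i + t)%N (i + p)%N ltac:(lia) ltac:(lia).
  by rewrite {2}/d addnS -natr1; lra.
have Hq t : (t <= q.+1)%N -> f (i + p + t)%N - f (i + p)%N <= t%:R * d (i + p)%N.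
  elim: t => [|t IH] tq; first by rewrite mul0r addn0 subrr.
  have := IH ltac:(lia).
  have := dle (i + p)%N (i + p + t)%N ltac:(lia) ltac:(lia).
  by rewrite {1}/d !addnS -natr1; lra.
have := Hp p (leqnn p); have := Hq q.+1 (leqnn _).
have : 0 <= p%:R :> R by []. have : 0 <= q.+1%:R :> R by [].
rewrite natrD; move: (q.+1%:R) (p%:R) (d _) => Q P D; nra.
Qed.

Lemma prefix_mass_id i : prefix_mass (fun y => y%:R) i = (i * i.+1)%:R / 2.
Proof.
elim: i => [|i IH]; first by rewrite prefix_mass0 mul0n mul0r.
by rewrite prefix_massS IH !natrM -!natr1; field.
Qed.

(** The margin [k + 2 <= x] matters: for [x = 2], [k = 1] and [n >= 5] the ratio is 15/6. *)
Lemma interior_ball_id n x k : (1 <= k)%N -> (k + 2 <= x)%N -> (x + k <= n)%N ->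
  ball_mass n (fun y => y%:R) x (2 * k).+1
    <= 7 / 3 * ball_mass n (fun y => y%:R) x k.
Proof.
move=> k1 kx xn; rewrite !ball_mass_prefix; [|lia..]; rewrite !prefix_mass_id.
have -> : minn n (x + k) = (x + k)%N by lia.
suff : (3 * (minn n (x + (2 * k).+1) * (minn n (x + (2 * k).+1)).+1)
          + 7 * ((x - k).-1 * (x - k).-1.+1)
   <= 7 * ((x + k) * (x + k).+1)
        + 3 * ((x - (2 * k).+1).-1 * (x - (2 * k).+1).-1.+1))%N.
  by rewrite -(ler_nat R) !(natrD, natrM); lra.
have -> : (x - k).-1 = (x - k - 1)%N by lia.
set b := minn _ _; have bx : (b <= x + 2 * k + 1)%N by rewrite /b; lia.
have b2 : (b * b.+1 <= (x + 2 * k + 1) * (x + 2 * k + 2))%N by apply: leq_mul; lia.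
have [x2|x2] := leqP (2 * k + 2) x.
  have -> : (x - (2 * k).+1).-1 = (x - (2 * k + 2))%N by lia.
  (* Nonnegative slacks turn the truncated subtractions into polynomials for [nia]. *)
  have [t xE] : exists t, x = (2 * k + 2 + t)%N by exists (x - (2 * k + 2))%N; lia.
  have [k' kE] : exists k', k = k'.+1 by exists k.-1; lia.
  rewrite (_ : x - k - 1 = k + 1 + t)%N; last by lia.
  rewrite (_ : x - (2 * k + 2) = t)%N; last by lia.
  by move: b2; rewrite xE kE; nia.
rewrite (_ : (x - (2 * k).+1).-1 = 0)%N; last by lia.
have [t xE] : exists t, x = (k + 2 + t)%N by exists (x - (k + 2))%N; lia.
have [w kE] : exists w, k = (1 + t + w)%N by exists (k - 1 - t)%N; lia.
rewrite (_ : x - k - 1 = t + 1)%N; last by lia.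
by move: b2; rewrite xE kE; nia.
Qed.

(** Reduction to affine weights: [f] lies above its chord on the small ball and below the extended
    chord outside, so the difference satisfies the bound even with constant 1. *)
Lemma interior_ball_concave n f x k : concave_upto n.+1 f ->
  0 <= f 0%N -> 0 <= f n.+1 ->
  (1 <= k)%N -> (k + 2 <= x)%N -> (x + k + 1 <= n)%N ->
  ball_mass n f x (2 * k).+1 <= 7 / 3 * ball_mass n f x k.
Proof.
move=> cf f0 fn k1 kx xn.
have [a aE] : exists a, x = (a + k)%N by exists (x - k)%N; lia.
have [b bE] : exists b, b = (x + k)%N by exists (x + k)%N.
pose N : R := n.+1%:R; have N0 : 0 < N by rewrite ltr0n.
pose P (y : R) := (b%:R - y) * f a + (y - a%:R) * f b.
pose u y : R := (n.+1 - y)%N%:R.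
pose c0 := P 0 / N; pose c1 := P N / N.
(* [g] is [2k] times the difference of [f] and its chord [P / 2k] over the ball;
   [P] is a nonnegative combination of [n + 1 - y] and [y]. *)
pose g y := (2 * k)%:R * f y - c0 * u y - c1 * y%:R.
(* The extended chord is above [f] off the ball, so [P] is at least [2 * k] times the nonnegative
   [f] at 0 and at [n.+1]. *)
have P0 : 0 <= P 0.
  have := @concave_chord n.+1 f 0 a (2 * k) cf ltac:(lia).
  have -> : (0 + a + 2 * k)%N = b by lia.
  by rewrite /P add0n; have := mulr_ge0 (ler0n R (2 * k)) f0; lra.
have PN : 0 <= P N.
  have := @concave_chord n.+1 f a (2 * k) (n.+1 - b) cf ltac:(lia).
  have -> : (a + 2 * k + (n.+1 - b))%N = n.+1 by lia.
  have -> : (a + 2 * k)%N = b by lia.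
  rewrite (_ : (2 * k + (n.+1 - b)) = n.+1 - a)%N; last by lia.
  have an : (a <= n.+1)%N by lia.
  have bn : (b <= n.+1)%N by lia.
  rewrite !natrB // -/N /P; have := mulr_ge0 (ler0n R (2 * k)) fn. lra.
have split_ball r : (2 * k)%:R * ball_mass n f x r = ball_mass n g x r
    + c0 * ball_mass n u x r + c1 * ball_mass n (fun y => y%:R) x r.
  rewrite /ball_mass !mulr_sumr -!big_split /=.
  by apply: eq_bigr => y _; rewrite /g; ring.
have gE y : (y <= n)%N -> g y = (2 * k)%:R * f y - P y%:R.
  move=> yn; rewrite /g /u natrB; last lia.
  by rewrite -/N /c0 /c1 /P; field; rewrite nat1r gt_eqF.
have g_in y : (a <= y <= b)%N -> 0 <= g y.
  move=> yab; rewrite gE; last by lia.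
  have := @concave_chord n.+1 f a (y - a) (b - y) cf ltac:(lia).
  have -> : (a + (y - a) + (b - y))%N = b by lia.
  have -> : (a + (y - a))%N = y by lia.
  rewrite (_ : (y - a + (b - y)) = 2 * k)%N; last by lia.
  by rewrite /P !natrB; [lra|lia..].
have g_out y : (y <= n)%N -> (y < a)%N || (b < y)%N -> g y <= 0.
  move=> yn; rewrite gE // => /orP[ya|yb].
    have := @concave_chord n.+1 f y (a - y) (2 * k) cf ltac:(lia).
    have -> : (y + (a - y) + 2 * k)%N = b by lia.
    have -> : (y + (a - y))%N = a by lia.
    rewrite (_ : (a - y + 2 * k) = b - y)%N; last by lia.
    by rewrite /P !natrB; [lra|lia..].
  have := @concave_chord n.+1 f a (2 * k) (y - b) cf ltac:(lia).
  have -> : (a + 2 * k + (y - b))%N = y by lia.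
  have -> : (a + 2 * k)%N = b by lia.
  rewrite (_ : (2 * k + (y - b)) = y - a)%N; last by lia.
  by rewrite /P !natrB; [lra|lia..].
have ball_g : ball_mass n g x (2 * k).+1 <= 7 / 3 * ball_mass n g x k.
  rewrite /ball_mass mulr_sumr [leLHS]big_mkcond [leRHS]big_mkcond /=.
  apply: ler_sum_nat => y yn; have [yk|yk] := leqP (ldist x y) k.
    have -> : (ldist x y <= (2 * k).+1)%N by lia.
    by have := g_in y ltac:(rewrite /ldist in yk *; lia); lra.
  have := g_out y ltac:(lia) ltac:(rewrite /ldist in yk *; lia).
  by case: ifP.
have ball_u : ball_mass n u x (2 * k).+1 <= 7 / 3 * ball_mass n u x k.
  rewrite -!(@ball_mass_reflect n (fun y => y%:R)); [|lia..].
  by apply: interior_ball_id; lia.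
have ball_id := @interior_ball_id n x k k1 kx ltac:(lia).
have c00 : 0 <= c0 by rewrite divr_ge0 // ltW.
have c10 : 0 <= c1 by rewrite divr_ge0 // ltW.
have k0 : 0 < (2 * k)%:R :> R by rewrite ltr0n; lia.
rewrite -(ler_pM2l k0) mulrCA !split_ball.
have := ler_wpM2l c00 ball_u; have := ler_wpM2l c10 ball_id.
lra.
Qed.

(** * Trigonometric inequalities *)

Lemma sin_pi6 : sin (pi / 6) = 1 / 2 :> R.
Proof.
have p := pi_gt0 R; set u : R := pi / 6.
have cu : 0 < cos u by apply: cos_gt0_pihalf; rewrite /u; lra.
(* Since pi/2 - u = 2u, cos u equals sin 2u. *)
have : cos u = 2 * (cos u * sin u).
  rewrite -[LHS]cosN -sinDpihalf.
  have -> : - u + pi / 2 = u *+ 2 by rewrite /u; lra.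
  by rewrite sin_mulr2n mulr_natl.
nra.
Qed.

Lemma sin_sumE (x y : R) : sin (x + y) + sin (x - y) = 2 * sin x * cos y.
Proof. by rewrite sinB sinD; ring. Qed.

Lemma cos_diffE (x y : R) : cos (x - y) - cos (x + y) = 2 * sin x * sin y.
Proof. by rewrite cosB cosD; ring. Qed.

(** Follows from the product formula for a difference of sines; [y] may exceed [pi / 2]. *)
Lemma le_sin (x y : R) : 0 <= y - x <= 2 * pi -> - pi <= x + y <= pi ->
  sin x <= sin y.
Proof.
move=> yx xy; rewrite -subr_ge0.
have -> : sin y - sin x = 2 * sin ((y - x) / 2) * cos ((x + y) / 2).
  have := sin_sumE ((y - x) / 2) ((x + y) / 2).
  have -> : (y - x) / 2 + (x + y) / 2 = y by field.
  have -> : (y - x) / 2 - (x + y) / 2 = - x by field.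
  by rewrite sinN.
by rewrite !mulr_ge0 // ?sin_ge0_pi ?cos_ge0_pihalf //; lra.
Qed.

(** The worst case is a = pi/6, where the left side is largest and the right side smallest. There
    the claim becomes sin(pi/6 + h) <= sin(pi/6 + 3h). *)
Lemma sin3D_le (a h : R) : 0 <= h -> h <= pi / 6 -> pi / 6 <= a ->
  a + h <= pi / 2 ->
  sin (3 * a + h) <= 2 * cos (2 * h) * sin (a + h).
Proof.
move=> h0 h6 a6 ah; have p := pi_gt0 R.
have c2 : 0 <= cos (2 * h) by apply: cos_ge0_pihalf; lra.
have cosE : cos h = sin (pi / 2 - h) by rewrite addrC sinDpihalf cosN.
have lhs : sin (3 * a + h) <= cos h.
  have -> : sin (3 * a + h) = sin (pi - (3 * a + h)).
    by rewrite [pi - _]addrC sinDpi sinN opprK.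
  by rewrite cosE; apply: le_sin; lra.
apply: le_trans lhs _.
have : sin (pi / 6 + h) <= sin (a + h) by apply: le_sin; lra.
move/(ler_wpM2l c2) => H.
suff : cos h <= 2 * sin (pi / 6 + h) * cos (2 * h) by lra.
have := sin_sumE (pi / 6) h; rewrite sin_pi6.
have := sin_sumE (pi / 6 + h) (2 * h).
have -> : pi / 6 + h - 2 * h = pi / 6 - h by ring.
have : sin (pi / 6 + h) <= sin (pi / 6 + h + 2 * h) by apply: le_sin; lra.
lra.
Qed.

(** * The sine weight and its ball masses *)

Definition path_angle (n : nat) : R := pi / n.+1%:R.

Definition sine_weight (n j : nat) : R := sin (j%:R * path_angle n).

Lemma path_angle_gt0 n : 0 < path_angle n.
Proof. by rewrite divr_gt0 // pi_gt0. Qed.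

Lemma path_angleE n : n.+1%:R * path_angle n = pi.
Proof. by rewrite /path_angle mulrC divfK // gt_eqF. Qed.

Lemma sine_weight0 n : sine_weight n 0 = 0.
Proof. by rewrite /sine_weight mul0r sin0. Qed.

Lemma sine_weight_last n : sine_weight n n.+1 = 0.
Proof. by rewrite /sine_weight path_angleE sinpi. Qed.

Lemma sine_weight_measure n : is_measure n (sine_weight n).
Proof.
move=> j /andP[j0 jn]; apply: sin_gt0_pi.
by rewrite -(path_angleE n) mulr_gt0 ?ltr0n ?path_angle_gt0 //=
  ltr_pM2r ?path_angle_gt0 // ltr_nat.
Qed.

Lemma sine_weight_ge0 n j : (j <= n.+1)%N -> 0 <= sine_weight n j.
Proof.
case: j => [|j] jn; first by rewrite sine_weight0.
move: jn; rewrite ltnS leq_eqVlt => /orP[/eqP ->|jn].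
  by rewrite sine_weight_last.
by apply/ltW/sine_weight_measure.
Qed.

Lemma sine_weight_sym n j : (1 <= j <= n)%N -> sine_weight n (n.+1 - j)%N
  = sine_weight n j.
Proof.
move=> jn; rewrite /sine_weight natrB; last lia.
by rewrite mulrBl path_angleE addrC sinDpi sinN opprK.
Qed.

Lemma sine_weight_rec n j : sine_weight n j + sine_weight n j.+2
  = 2 * cos (path_angle n) * sine_weight n j.+1.
Proof.
rewrite /sine_weight; set y := j.+1%:R * path_angle n.
have -> : j%:R * path_angle n = y - path_angle n by rewrite /y -natr1; ring.
have -> : j.+2%:R * path_angle n = y + path_angle n.
  by rewrite /y -[in LHS]natr1; ring.
by rewrite addrC sin_sumE mulrAC.
Qed.

Lemma sine_weight_concave n : concave_upto n.+1 (sine_weight n).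
Proof.
move=> i iN; rewrite sine_weight_rec.
have := sine_weight_ge0 (n := n) (j := i.+1) ltac:(lia).
have := cos_le1 (path_angle n); nra.
Qed.

(** The weight vanishes at 0 and [n.+1], so [sine_weight_rec] also serves the truncated balls at the
    ends. *)
Lemma sine_weight_ball1 n x : (1 <= x <= n)%N -> ball_mass n (sine_weight n) x 1
  = (1 + 2 * cos (path_angle n)) * sine_weight n x.
Proof.
case: x => // x xn; rewrite ball_mass_prefix; last lia.
have -> : prefix_mass (sine_weight n) (minn n (x.+1 + 1))
    = prefix_mass (sine_weight n) x.+2.
  have [e|ne] := eqVneq x.+1 n.
    rewrite [RHS]prefix_massS e sine_weight_last addr0.
    by congr prefix_mass; lia.
  by congr prefix_mass; lia.
rewrite !prefix_massS mulrDl mul1r -sine_weight_rec subn1 /=.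
case: x xn => [|x] xn /=; first by rewrite prefix_mass0 sine_weight0; ring.
by rewrite prefix_massS; ring.
Qed.

(** Telescoping: 2 sin(jt) sin(t/2) = cos((j-1/2)t) - cos((j+1/2)t), with t the [path_angle n]. *)
Lemma sine_weight_prefix n i :
  2 * sin (path_angle n / 2) * prefix_mass (sine_weight n) i
    = cos (path_angle n / 2) - cos ((2 * i + 1)%:R * (path_angle n / 2)).
Proof.
elim: i => [|i IH]; first by rewrite prefix_mass0 mul1r subrr mulr0.
rewrite prefix_massS mulrDr IH.
have := cos_diffE (i.+1%:R * path_angle n) (path_angle n / 2).
have -> : i.+1%:R * path_angle n - path_angle n / 2
    = (2 * i + 1)%:R * (path_angle n / 2).
  by rewrite natrD natrM -natr1; field.
have -> : i.+1%:R * path_angle n + path_angle n / 2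
    = (2 * i.+1 + 1)%:R * (path_angle n / 2).
  by rewrite natrD natrM -natr1; field.
rewrite -/(sine_weight n i.+1); lra.
Qed.

Lemma sine_weight_end_ball n m : (3 <= n)%N -> (n < 3 * m)%N -> (2 * m <= n)%N ->
  prefix_mass (sine_weight n) (2 * m)
    <= (1 + 2 * cos (path_angle n)) * prefix_mass (sine_weight n) m.
Proof.
move=> n3 m3 m2; pose h : R := path_angle n / 2; pose a := m%:R * h.
have p := pi_gt0 R.
have nh : n.+1%:R * h = pi / 2 by rewrite /h mulrA path_angleE.
have h0 : 0 < h by rewrite divr_gt0 ?path_angle_gt0.
have nat_le (i j : nat) : (i <= j)%N -> i%:R * h <= j%:R * h.
  by move=> ij; rewrite ler_pM2r // ler_nat.
have h6 : h <= pi / 6 by have := nat_le 3%N n.+1 ltac:(lia); lra.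
have a6 : pi / 6 <= a.
  by have := nat_le n.+1 (3 * m)%N ltac:(lia); rewrite nh natrM -mulrA -/a; lra.
have ah : 2 * a + h <= pi / 2.
  have := nat_le (2 * m + 1)%N n.+1 ltac:(lia).
  by rewrite nh natrD natrM mulrDl -mulrA mul1r.
have sh : 0 < 2 * sin h by rewrite mulr_gt0 // sin_gt0_pi //; lra.
(* The two sums become 2 sin(2a+h) sin(2a) and 2 sin(a+h) sin(a); taking out sin(a) leaves
   [sin3D_le]. *)
rewrite -(ler_pM2l sh) mulrCA !sine_weight_prefix -/h.
have -> : (2 * (2 * m) + 1)%:R * h = (2 * a + h) + 2 * a.
  by rewrite natrD !natrM /a; ring.
have -> : (2 * m + 1)%:R * h = (a + h) + a by rewrite natrD !natrM /a; ring.
have E1 := cos_diffE (2 * a + h) (2 * a); rewrite addrAC subrr add0r in E1.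
have E2 := cos_diffE (a + h) a; rewrite addrAC subrr add0r in E2.
have E3 := sin_sumE (2 * a + h) a.
have E4 : sin (2 * a) = 2 * (cos a * sin a).
  by rewrite mulr_natl sin_mulr2n mulr_natl.
rewrite (_ : 2 * a + h + a = 3 * a + h) in E3; last by ring.
rewrite (_ : 2 * a + h - a = a + h) in E3; last by ring.
rewrite E1 E2 E4 (_ : path_angle n = 2 * h); last by rewrite /h; field.
have sa : 0 <= sin a by apply: sin_ge0_pi; lra.
have := ler_wpM2l sa (@sin3D_le a h ltac:(lra) h6 a6 ltac:(lra)).
have := congr1 ( *%R (sin a)) E3; rewrite /=; lra.
Qed.

(** * Pairing a minimizer with the sine weight *)

Lemma ball_mass0 n mu x : (1 <= x <= n)%N -> ball_mass n mu x 0 = mu x.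
Proof.
case: x => // x xn; rewrite ball_mass_prefix; last lia.
by rewrite addn0 subn0 (minn_idPr xn) prefix_massS /= addrAC subrr add0r.
Qed.

(** The kernel [ldist x y <= r] is symmetric, so taking ball masses is self-adjoint. *)
Lemma ball_mass_exchange n f g r :
  \sum_(1 <= x < n.+1) f x * ball_mass n g x r
    = \sum_(1 <= x < n.+1) g x * ball_mass n f x r.
Proof.
have E u v x : u x * ball_mass n v x r
    = \sum_(1 <= y < n.+1) if (ldist x y <= r)%N then u x * v y else 0.
  by rewrite /ball_mass mulr_sumr big_mkcond.
under eq_bigr do rewrite E; under [RHS]eq_bigr do rewrite E.
rewrite exchange_big /=; apply: eq_bigr => y _; apply: eq_bigr => x _.
by rewrite /ldist addnC mulrC.
Qed.

Lemma C_L_gt_eigenvalue n mu : (0 < n)%N -> doubling_minimizer n mu ->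
  ~ tight n mu 1 0 -> 1 + 2 * cos (path_angle n) < C_L n.
Proof.
move=> n0 Hmu N1; have mu0 := Hmu.1; set s := sine_weight n.
have s0 : is_measure n s by exact: sine_weight_measure.
rewrite ltNge; apply/negP => C.
have n1 : (1 <= 1 <= n)%N by rewrite n0.
(* Vertex 1 supplies the strictness of the summed inequality. *)
have lt1 : s 1%N * ball_mass n mu 1 1 < mu 1%N * (C_L n * s 1%N).
  have := not_tight_lt Hmu n1 N1; rewrite ball_mass0 // => lt1.
  by rewrite (mulrC (C_L n)) mulrCA ltr_pM2l ?s0 // mulrC.
have : \sum_(1 <= x < n.+1) s x * ball_mass n mu x 1
     < \sum_(1 <= x < n.+1) mu x * (C_L n * s x).
  rewrite [ltLHS]big_ltn // [ltRHS]big_ltn //.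
  apply: ltr_leD => //.
  rewrite big_seq [leRHS]big_seq; apply: ler_sum => x.
  rewrite mem_index_iota => xn.
  have := (doubling_minimizerP n0 mu0).1 Hmu x 0%N ltac:(lia).
  rewrite ball_mass0; last lia.
  by move/(ler_wpM2l (ltW (s0 x ltac:(lia)))); lra.
rewrite ball_mass_exchange; apply/negP; rewrite -leNgt.
rewrite big_seq [leRHS]big_seq; apply: ler_sum => x; rewrite mem_index_iota => xn.
by rewrite sine_weight_ball1 // !ler_wpM2l ?ler_wpM2r // ltW // ?s0 ?mu0.
Qed.

(** * A tight constraint at the end vertex *)

Section SymmetricMinimizer.

Context (n : nat) (mu : nat -> R).
Context (n3 : (3 <= n)%N) (Hmu : doubling_minimizer n mu).
Context (sym : forall v, (1 <= v <= n)%N -> mu (n.+1 - v)%N = mu v).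

(** By symmetry the first and the last [m] vertices have equal mass, and together they cover the
    path. *)
Lemma prefix_mass_half m : (m <= n)%N -> (n <= 2 * m)%N ->
  prefix_mass mu n <= 2 * prefix_mass mu m.
Proof.
move=> mn nm; have mu0 := Hmu.1.
have := @ball_mass_symmetric n mu 1 m.-1 sym ltac:(lia).
rewrite !ball_mass_prefix; [|lia..].
rewrite (_ : minn n (n.+1 - 1 + m.-1) = n); last lia.
rewrite (_ : minn n (1 + m.-1) = m); last lia.
rewrite (_ : (1 - m.-1).-1 = 0)%N ?prefix_mass0; last lia.
have := @prefix_mass_le n mu (n.+1 - 1 - m.-1).-1 m mu0 ltac:(lia).
lra.
Qed.

Lemma left_ball x k : (1 <= x <= n)%N -> (x <= k.+1)%N ->
  ball_mass n mu x k = prefix_mass mu (minn n (x + k)).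
Proof.
move=> xn xk; rewrite ball_mass_prefix; last lia.
by rewrite (_ : (x - k).-1 = 0)%N ?prefix_mass0 ?subr0 //; lia.
Qed.

(** The small ball holds at least half of the total mass, so the ratio is at most 2. *)
Lemma large_left_ball_lt x k : (1 <= x <= n)%N -> (x <= k.+1)%N ->
  (n <= 2 * (x + k))%N ->
  ball_mass n mu x (2 * k).+1 < C_L n * ball_mass n mu x k.
Proof.
move=> xn xk nk; have mu0 := Hmu.1; rewrite !left_ball //; last lia.
have W := @prefix_mass_lt n mu 0 (minn n (x + k)) mu0 ltac:(lia).
have := @prefix_mass_le n mu (minn n (x + (2 * k).+1)) n mu0 ltac:(lia).
have := @prefix_mass_half (minn n (x + k)) ltac:(lia) ltac:(lia).
by have := C_L_gt n3 Hmu; rewrite prefix_mass0 in W; nra.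
Qed.

(* The constraint of the ball of radius [x + k - 1] around [1] is stronger. *)
Lemma shifted_left_ball_lt x k : (2 <= x <= n)%N -> (x <= k.+1)%N ->
  ball_mass n mu x (2 * k).+1 < C_L n * ball_mass n mu x k.
Proof.
move=> xn xk; have mu0 := Hmu.1.
have [nk|kn] := leqP n (2 * (x + k)); first by apply: large_left_ball_lt => //; lia.
have n0 : (0 < n)%N by lia.
have := (doubling_minimizerP n0 mu0).1 Hmu 1%N (x + k - 1)%N ltac:(lia).
rewrite !left_ball; [|lia..].
rewrite (_ : minn n (1 + (x + k - 1)) = minn n (x + k)); last lia.
have := @prefix_mass_lt n mu (minn n (x + (2 * k).+1))
  (minn n (1 + (2 * (x + k - 1)).+1)) mu0 ltac:(lia).
lra.
Qed.

Lemma exists_tight_end : exists2 k, (3 * k.+1 <= n)%N & tight n mu 1 k.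
Proof.
have [//|Nk] := pselect (exists2 k, (3 * k.+1 <= n)%N & tight n mu 1 k).
have C73 := C_L_gt n3 Hmu; have n0 : (0 < n)%N by lia.
set s := sine_weight n; have s0 : is_measure n s by exact: sine_weight_measure.
have Clam : 1 + 2 * cos (path_angle n) < C_L n.
  by apply: (C_L_gt_eigenvalue n0 Hmu) => t1; apply: Nk; exists 0%N => //; lia.
pose good x k := ball_mass n mu x (2 * k).+1 < C_L n * ball_mass n mu x k \/
                 ball_mass n s x (2 * k).+1 < C_L n * ball_mass n s x k.
have good_left x k : (1 <= x <= n)%N -> (x <= k.+1)%N -> good x k.
  move=> xn xk; have [x1|x2] := leqP 2 x.
    by left; apply: shifted_left_ball_lt => //; lia.
  have -> : x = 1%N by lia.
  have [nk|kn] := leqP n (2 * k.+1); first by left; apply: large_left_ball_lt; lia.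
  have [k3|k3] := leqP (3 * k.+1) n.
    by left; apply: not_tight_lt => // t1; apply: Nk; exists k.
  (* The remaining radii, with 2(k+1) < n < 3(k+1), are relaxed by the sine weight. *)
  right; have := @sine_weight_end_ball n k.+1 n3 k3 ltac:(lia).
  rewrite !ball_mass_prefix //.
  rewrite (_ : (1 - (2 * k).+1).-1 = 0)%N; last lia.
  rewrite (_ : (1 - k).-1 = 0)%N; last lia.
  rewrite (_ : minn n (1 + (2 * k).+1) = 2 * k.+1)%N; last lia.
  rewrite (_ : minn n (1 + k) = k.+1)%N; last lia.
  rewrite !prefix_mass0 !subr0 -/s.
  have := @prefix_mass_lt n s 0 k.+1 s0 ltac:(lia); rewrite prefix_mass0.
  nra.
case: (@no_improving_direction n mu s n0 Hmu) => x k xn; rewrite -/(good x k).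
have [xk|kx] := leqP x k.+1; first exact: good_left.
(* Balls containing [n] are reflected to balls containing 1. *)
have [nx|xk] := leqP n (x + k).
  have := good_left (n.+1 - x)%N k ltac:(lia) ltac:(lia).
  rewrite /good !ball_mass_symmetric //; exact: sine_weight_sym.
right; have [k0|k0] := posnP k.
  rewrite k0 sine_weight_ball1 // ball_mass0 //.
  by rewrite ltr_pM2r // s0.
have := @interior_ball_concave n s x k (@sine_weight_concave n)
  (sine_weight_ge0 (leq0n _)) (sine_weight_ge0 (leqnn _)) k0 ltac:(lia) ltac:(lia).
have := ball_mass_gt0 k s0 xn; nra.
Qed.

End SymmetricMinimizer.

Unset Implicit Arguments.

Theorem theorem6p6 (n : nat) : (3 <= n)%N ->
  exists j k : nat,
    (2 <= j <= ceil_div n 2)%N /\ (k < ceil_div (n - 2) 3)%N /\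
    forall mu : nat -> Rdefinitions.R, doubling_minimizer n mu ->
      ball_mass n mu j 1 / ball_mass n mu j 0
        = ball_mass n mu 1 (2 * k).+1 / ball_mass n mu 1 k /\
      ball_mass n mu 1 (2 * k).+1 / ball_mass n mu 1 k = C_mu n mu.
Proof.
move=> n3; have n0 : (0 < n)%N by lia.
have [[mu Hmu]|Nmu] := pselect (exists mu, doubling_minimizer n mu); last first.
  (* Without minimizers any pair in range will do. *)
  exists 2%N, 0%N; rewrite /ceil_div; split; first lia; split; first lia.
  by move=> mu Hmu; case: Nmu; exists mu.
pose t := [seq (x, k) | x <- iota 1 n, k <- iota 0 n].
have [m Hm m_tight] := @exists_common_tight n t mu n0 Hmu.
have Hm' := doubling_minimizer_reflect n0 Hm.
(* Symmetric, and by [tightD] its tight constraints are tight for [m], hence for all minimizers. *)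
pose w y := m y + 1 * m (n.+1 - y)%N.
have Hw : doubling_minimizer n w by exact: doubling_minimizerD.
have w_sym v : (1 <= v <= n)%N -> w (n.+1 - v)%N = w v.
  move=> vn; rewrite /w (_ : n.+1 - (n.+1 - v) = v)%N; last lia.
  by rewrite !mul1r addrC.
have w_tight x k : (1 <= x <= n)%N -> (k < n)%N -> tight n w x k ->
    forall nu, doubling_minimizer n nu -> tight n nu x k.
  move=> xn kn /tightD [] // tm _; apply: m_tight => //.
  by apply/allpairsP; exists (x, k); rewrite !mem_iota; split => //=; lia.
have [j jn tj] : exists2 j, (2 <= j <= ceil_div n 2)%N & tight n w j 0.
  have [j jn tj] := exists_tight_center n3 Hw.
  have [jh|jh] := leqP j (ceil_div n 2); first by exists j => //; lia.
  exists (n.+1 - j)%N; first by move: jh; rewrite /ceil_div; lia.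
  by rewrite /tight !ball_mass_symmetric //; lia.
have [k kn tk] := exists_tight_end n3 Hw w_sym.
have jn' : (1 <= j <= n)%N by move: jn; rewrite /ceil_div; lia.
(* [ceil_div (n - 2) 3] is the floor of n/3, so the bound on [k] amounts to [3 * k.+1 <= n]. *)
exists j, k; split => //; split; first by rewrite /ceil_div; lia.
move=> nu Hnu; have [nu0 ->] := Hnu.
have ratio x i : (1 <= x <= n)%N -> (i < n)%N -> tight n w x i ->
    ball_mass n nu x (2 * i).+1 / ball_mass n nu x i = C_L n.
  move=> xn ni /(w_tight _ _ xn ni) /(_ nu Hnu) ->.
  by rewrite mulfK // gt_eqF // ball_mass_gt0.
by rewrite (ratio 1%N k) ?(ratio j 0%N) //; lia.
Qed.
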